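(* For $\mathbf{M}_1,\mathbf{M}_2\in\mathcal{A}$, if $\mathbf{M}_1$ is cross ratio equivalent to $\mathbf{M}_2$, then $\mathrm{CI}(\mathbf{M}_1)=\mathrm{CI}(\mathbf{M}_2)$.
   Context: All matrices are real, non-negative and have no zero rows or zero columns. For an $n\times n$ matrix $A=(a_{ij})$ and $\sigma\in S_n$, the set $\{a_{1,\sigma(1)},\dots,a_{n,\sigma(n)}\}$ is the diagonal of $A$ determined by $\sigma$; it is positive if all $a_{i,\sigma(i)}>0$. $\mathcal{A}$ is the set of $n\times n$ matrices that have at least one positive diagonal. Sinkhorn (SK) iteration of $\mathbf{M}$ alternately normalizes rows (dividing each row by its sum) and columns (dividing each column by its sum), starting with rows, producing row normalized matrices $\mathbf{L}^k$ and column normalized matrices $\mathbf{T}^k$. By Sinkhorn and Knopp, for $\mathbf{M}\in\mathcal{A}$ the iteration converges to a single doubly stochastic matrix $\mathbf{M}^*$, so $\mathbf{L}=\lim\mathbf{L}^k=\lim\mathbf{T}^k=\mathbf{T}=\mathbf{M}^*$. The cooperative index is $\mathrm{CI}(\mathbf{M})=\frac1n\sum_{i,j}l_{ij}t_{ij}$ with $\mathbf{L}=(l_{ij})$, $\mathbf{T}=(t_{ij})$, i.e. $\mathrm{CI}(\mathbf{M})=\frac1n\sum_{i,j}(m^*_{ij})^2$ for $\mathbf M\in\mathcal A$. Cross ratio equivalence: for $\sigma\in S_n$ put $d^A_\sigma=\prod_{i=1}^n a_{i,\sigma(i)}$. Two $n\times n$ matrices $A,B$ are cross ratio equivalent if for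 every $\sigma\in S_n$, $d^A_\sigma\neq0\Longleftrightarrow d^B_\sigma\neq 0$, and $d^A_\sigma/d^A_{\sigma'}=d^B_\sigma/d^B_{\sigma'}$ for all $\sigma,\sigma'\in S_n$ determining positive diagonals of $A$. *)

(* Defs.v *)
From mathcomp Require Import all_boot all_order all_algebra all_fingroup.
From mathcomp Require Import all_classical all_reals all_analysis.

Set Implicit Arguments.
Unset Strict Implicit.
Unset Printing Implicit Defensive.

Import Order.TTheory GRing.Theory Num.Theory.
Import numFieldNormedType.Exports.

Local Open Scope ring_scope.
Local Open Scope classical_set_scope.

Section SinkhornIteration.
Context {R : realType} {n : nat}.
Implicit Types (A B M : 'M[R]_n) (s : 'S_n).

(* The matrices under consideration: non-negative, with no zero row and no
   zero column. *)
Definition admissible A : Prop :=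
  [/\ forall i j, 0 <= A i j,
      forall i, exists j, A i j != 0 &
      forall j, exists i, A i j != 0].

Definition positive_diagonal A s : Prop := forall i, 0 < A i (s i).

Definition has_positive_diagonal A : Prop :=
  admissible A /\ exists s, positive_diagonal A s.

Definition row_normalize A : 'M[R]_n :=
  \matrix_(i, j) (A i j / \sum_(k < n) A i k).

Definition col_normalize A : 'M[R]_n :=
  \matrix_(i, j) (A i j / \sum_(k < n) A k j).

(* Indexing starts at 0: [SK_row M k] and [SK_col M k] are the (k+1)-st row
   normalized and column normalized matrices of the iteration, so that
   [SK_row M 0 = row_normalize M] and
   [SK_row M k.+1 = row_normalize (SK_col M k)]. *)
Definition SK_row M (k : nat) : 'M[R]_n :=
  row_normalize (iter k (fun A => col_normalize (row_normalize A)) M).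

Definition SK_col M (k : nat) : 'M[R]_n := col_normalize (SK_row M k).

Definition SK_row_lim M : 'M[R]_n := lim (SK_row M @ \oo).

Definition SK_col_lim M : 'M[R]_n := lim (SK_col M @ \oo).

(* Meaningful when both limits exist; [lim] is an arbitrary matrix otherwise. *)
Definition cooperative_index M : R :=
  n%:R^-1 * \sum_(i < n) \sum_(j < n) SK_row_lim M i j * SK_col_lim M i j.

Definition diagonal_product A s : R := \prod_(i < n) A i (s i).

Definition cross_ratio_equivalent A B : Prop :=
  (forall s, diagonal_product A s != 0 <-> diagonal_product B s != 0) /\
  (forall s s', positive_diagonal A s -> positive_diagonal A s' ->
     diagonal_product A s / diagonal_product A s' =
     diagonal_product B s / diagonal_product B s').

End SinkhornIteration.

(* Main.v *)
(** Row or column normalization multiplies all diagonal products of a matrix by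
    the same factor, and by AM-GM this factor is at least 1 when the other line
    sums are 1, since the normalized line sums then add up to [n].  Hence the
    product along a fixed positive diagonal increases along the Sinkhorn
    iteration and converges, so the products of the line sums tend to 1.  By the
    equality case of AM-GM every cluster point is doubly stochastic; its diagonal
    products are proportional to those of the initial matrix.  There is only one
    such doubly stochastic matrix, so by compactness both halves of the iteration
    converge to it, and it depends only on the cross ratios. *)

Require Import Defs.
From mathcomp Require Import all_boot all_order all_algebra all_fingroup.
From mathcomp Require Import all_classical all_reals all_analysis.
From mathcomp Require Import zify.

Set Implicit Arguments.
Unset Strict Implicit.
Unset Printing Implicit Defensive.

Import Order.TTheory GRing.Theory Num.Theory.
Import numFieldNormedType.Exports.

Local Open Scope ring_scope.

(** * Hall's marriage theorem *)

(** Induction on the size of [A]. If a nonempty proper subset [X] is tight, meaning that it has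
    exactly [#|X|] neighbours, then [X] is matched inside [N X] and the rest of [A] outside it.
    Otherwise any element may take any of its neighbours. The function [g0] only provides values
    when [A] is empty. *)
Lemma hall_marriage (S T : finType) (g0 : S -> T) (f : S -> {set T})
    (A : {set S}) :
  (forall X : {set S}, X \subset A -> (#|X| <= #|(\bigcup_(x in X) f x)%SET|)%N) ->
  exists g : S -> T,
    {in A, forall x, g x \in f x} /\ {in A &, injective g}.
Proof.
have [k] := ubnP #|A|; elim: k f A => // k IHk f A leAk hallA.
have [->|[x xA]] := finset.set_0Vmem A.
  by exists g0; split => [z|z t]; rewrite inE.
pose N (X : {set S}) : {set T} := (\bigcup_(z in X) f z)%SET.
have [X /andP[/andP[XA X0] /eqP tight]|notight] := pickP [pred X : {set S} |
    (X \proper A) && (X != finset.set0) && (#|N X| == #|X|)].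
  have [sXA _] := andP XA.
  have [|Y sYX|g1 [g1f g1inj]] := IHk f X.
  - exact: leq_trans (proper_card XA) leAk.
  - exact/hallA/(fintype.subset_trans sYX).
  have [|Y sYAX|g2 [g2f g2inj]] := IHk (fun z => f z :\: N X)%SET (A :\: X)%SET.
  - rewrite cardsD (finset.setIidPr sXA); apply: (@leq_trans #|A|); last exact: leAk.
    by rewrite ltn_subrL !card_gt0 X0; apply/finset.set0Pn; exists x.
  (* Outside [N X], the neighbours of [Y] are those of [X :|: Y]. Hall's condition for [X :|: Y],
     minus the equality for [X], gives the condition for [Y]. *)
  - have -> : (\bigcup_(z in Y) (f z :\: N X) = N (X :|: Y) :\: N X)%SET.
      apply/finset.setP => t; rewrite !inE; apply/bigcupP/andP.
        move=> [z zY]; rewrite inE => /andP[tN tf]; split => //.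
        by apply/bigcupP; exists z => //; rewrite inE zY orbT.
      move=> [tN /bigcupP[z]]; rewrite inE => /orP[zX tf|zY tf].
        by case/negP: tN; apply/bigcupP; exists z.
      by exists z => //; rewrite inE tN.
    have sN : (N X \subset N (X :|: Y))%SET.
      apply/fintype.subsetP => t /bigcupP[z zX tf]; apply/bigcupP; exists z => //.
      by rewrite inE zX.
    rewrite cardsD (finset.setIidPr sN) tight.
    have dXY : [disjoint X & Y].
      rewrite disjoint_sym; apply: disjointWl sYAX _.
      by rewrite -setI_eq0 finset.setIDAC finset.setDIl finset.setDv finset.setI0.
    have := hallA (X :|: Y)%SET; rewrite cardsU (disjoint_setI0 dXY) cards0 subn0.
    rewrite finset.subUset sXA (fintype.subset_trans sYAX (finset.subsetDl _ _)).
    by move=> /(_ isT); rewrite -/(N _); lia.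
  exists (fun z => if z \in X then g1 z else g2 z); split.
    move=> z zA; case: ifP => zX; first exact: g1f.
    by have := g2f z; rewrite !inE zX zA => /(_ isT)/andP[].
  have cross z t : z \in X -> t \in A -> t \notin X -> g1 z <> g2 t.
    move=> zX tA tX e; have := g2f t; rewrite !inE tX tA => /(_ isT)/andP[].
    by case/negP; rewrite -e; apply/bigcupP; exists z => //; exact: g1f.
  move=> z t zA tA; case: ifPn => zX; case: ifPn => tX.
  - exact: g1inj.
  - by move/(cross _ _ zX tA tX).
  - by move/esym/(cross _ _ tX zA zX).
  - by apply: g2inj; rewrite inE ?zX ?tX.
have [y yf] : exists y, y \in f x.
  apply/finset.set0Pn; rewrite -card_gt0; have := hallA [set x]%SET.
  by rewrite cards1 big_set1; apply; rewrite finset.sub1set.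
have [|Y sY|g [gf ginj]] := IHk (fun z => f z :\ y)%SET (A :\ x)%SET.
- by move: leAk; rewrite (cardsD1 x) xA.
- have -> : (\bigcup_(z in Y) (f z :\ y) = N Y :\ y)%SET.
    apply/finset.setP => t; rewrite !inE; apply/bigcupP/andP.
      move=> [z zY]; rewrite !inE => /andP[tN tf]; split => //.
      by apply/bigcupP; exists z.
    by move=> [tN /bigcupP[z zY tf]]; exists z => //; rewrite !inE tN.
  have [->|Y0] := eqVneq Y finset.set0; first by rewrite cards0.
  have sYA : Y \proper A := sub_proper_trans sY (properD1 xA).
  (* Not being tight, [Y] has a neighbour to spare, so the loss of [y] keeps Hall's condition. *)
  have := notight Y; rewrite /= sYA Y0 /= => /negbT neq.
  have := hallA Y (proper_sub sYA); rewrite -/(N Y) leq_eqVlt eq_sym (negPf neq).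
  by rewrite (cardsD1 y (N Y)); case: (y \in N Y); lia.
exists (fun z => if z == x then y else g z); split.
  move=> z zA; case: eqP => [-> //|/eqP zx].
  by have := gf z; rewrite !inE zx zA => /(_ isT)/andP[].
have cross t : t \in A -> t != x -> y <> g t.
  by move=> tA tx e; have := gf t; rewrite !inE tx tA -e eqxx => /(_ isT).
move=> z t zA tA; case: eqP => [->|/eqP zx]; case: eqP => [->|/eqP tx] //.
- by move/(cross _ tA tx).
- by move/esym/(cross _ zA zx).
- by apply: ginj; rewrite !inE ?zx ?tx.
Qed.

(** * Positive diagonals, and uniqueness of a doubly stochastic matrix with given cross ratios *)

Section DiagonalsOfDoublyStochasticMatrices.
Context {R : realType} {n : nat}.
Implicit Types (A B : 'M[R]_n) (s : 'S_n).

Definition nonnegative A : Prop := forall i j, 0 <= A i j.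

(** The common sum [r] is left free so that subtracting a multiple of a permutation matrix stays
    within the notion. *)
Definition line_sums A (r : R) : Prop :=
  (forall i, \sum_j A i j = r) /\ (forall j, \sum_i A i j = r).

(** Hall's condition by counting mass: the rows in [X] carry mass [#|X| * r], all of it in the
    columns of [N], whose total mass is [#|N| * r]. *)
Lemma line_sums_positive_diagonal A r :
  nonnegative A -> line_sums A r -> 0 < r -> exists s, positive_diagonal A s.
Proof.
move=> A0 [Ar Ac] r0; pose supp i := [set j | A i j != 0]%SET.
have [|g [gs ginj]] := @hall_marriage _ _ id supp [set: 'I_n]%SET.
  move=> X _; set N := (\bigcup_(x in X) supp x)%SET.
  rewrite -(ler_nat R) -(ler_pM2r r0).
  have -> : #|X|%:R * r = \sum_(i in X) \sum_(j in N) A i j.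
    rewrite mulr_natl -sumr_const; apply: eq_bigr => i iX; rewrite -(Ar i).
    rewrite [RHS]big_mkcond /=; apply: eq_bigr => j _; case: ifPn => // jN.
    apply/eqP; apply: contraNT jN => Aij; apply/bigcupP; exists i => //.
    by rewrite inE.
  rewrite exchange_big mulr_natl -sumr_const /=; apply: ler_sum => j _.
  by rewrite -(Ac j) [leLHS]big_mkcond ler_sum // => i _; case: ifP.
have injg : injective g by move=> i j; apply: ginj; rewrite inE.
exists (perm injg) => i; rewrite permE lt_def A0 andbT.
by have := gs i; rewrite !inE; apply.
Qed.

(* Birkhoff's theorem in dual form: a positive diagonal, weighted by its least
   entry, is subtracted repeatedly; each step kills an entry of [A]. *)
Lemma line_sums_weighted_sum A (x : 'I_n -> 'I_n -> R) r c :
    nonnegative A -> line_sums A r -> 0 <= r ->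
    (forall s, positive_diagonal A s -> \sum_i x i (s i) = c) ->
  \sum_i \sum_j A i j * x i j = r * c.
Proof.
have [k] := ubnP #|[set ij : 'I_n * 'I_n | A ij.1 ij.2 != 0]%SET|.
elim: k A r => // k IHk A r leAk A0 rA r0 xc.
move: r0; rewrite le_eqVlt => /predU1P[r0|r0].
  rewrite -r0 mul0r big1 // => i _; rewrite big1 // => j _.
  have := psumr_eq0P (P := predT) (fun j _ => A0 i j).
  by rewrite rA.1 -r0 => /(_ erefl j isT) ->; rewrite mul0r.
have [s As] := line_sums_positive_diagonal A0 rA r0.
(* The minimum below needs an index; for [n = 0] all sums are empty and [c = 0]. *)
have [i0 _|n0] := pickP 'I_n; last first.
  by rewrite -(xc _ As) !big1 ?mulr0 // => i; have := n0 i.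
case: (arg_minP (P := predT) (fun i => A i (s i)) (isT : predT i0)) => m _ minm.
set mu := A m (s m); pose A' := \matrix_(i, j) (A i j - mu * (s i == j)%:R).
have mu0 : 0 < mu by exact: As.
have A'0 : nonnegative A'.
  move=> i j; rewrite mxE subr_ge0; case: eqP => [<-|_].
    by rewrite mulr1 minm.
  by rewrite mulr0.
have A'le i j : A' i j <= A i j.
  by rewrite mxE gerBl mulr_ge0 // ltW.
have A'pos s' : positive_diagonal A' s' -> positive_diagonal A s'.
  by move=> h i; exact: lt_le_trans (h i) (A'le _ _).
have rowP i (F : 'I_n -> R) : \sum_j (s i == j)%:R * F j = F (s i).
  rewrite (bigD1 (s i)) //= eqxx mul1r big1 ?addr0 // => j.
  by rewrite eq_sym => /negPf ->; rewrite mul0r.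
have rA' : line_sums A' (r - mu).
  split=> [i|j].
    rewrite (eq_bigr _ (fun j _ => mxE _ _ i j)) sumrB rA.1 -mulr_sumr.
    under [X in mu * X]eq_bigr do rewrite -[_%:R]mulr1.
    by rewrite rowP mulr1.
  rewrite (eq_bigr _ (fun i _ => mxE _ _ i j)) sumrB rA.2 -mulr_sumr.
  rewrite (bigD1 (s^-1%g j)) //= permKV eqxx big1 ?addr0 ?mulr1 // => i ij.
  by rewrite -(can2_eq (permK s) (permKV s)) in ij; rewrite (negPf ij).
have r'0 : 0 <= r - mu.
  by rewrite -(rA'.1 m); apply: sumr_ge0 => j _; exact: A'0.
have := IHk A' (r - mu) _ A'0 rA' r'0 (fun s' h => xc s' (A'pos s' h)).
have -> : \sum_i \sum_j A' i j * x i j = \sum_i \sum_j A i j * x i j - mu * c.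
  rewrite -(xc _ As) mulr_sumr -sumrB; apply: eq_bigr => i _.
  rewrite -rowP mulr_sumr -sumrB; apply: eq_bigr => j _.
  by rewrite mxE mulrBl mulrA.
move=> /(_ _)/wrap[]; last first.
  by move=> /eqP; rewrite mulrBl subr_eq subrK => /eqP.
(* Since [A'] lies between 0 and [A], its support does not grow, and the least entry at [(m, s m)]
   has become 0. *)
rewrite -ltnS; apply: leq_trans leAk; rewrite ltnS; apply: proper_card.
apply/properP; split.
  apply/fintype.subsetP => -[i j]; rewrite !inE /= => A'ij.
  by rewrite gt_eqF // (lt_le_trans _ (A'le i j)) // lt_def A'ij A'0.
exists (m, s m); rewrite !inE /=; first by rewrite gt_eqF.
by rewrite mxE eqxx mulr1 subrr eqxx.
Qed.

(** The weighted sum is applied to the indicator of [(i, j)]. If no positive diagonal met this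
    position, the indicator would sum to 0 along each of them, forcing [A i j = 0]. *)
Lemma line_sums_total_support A r i j :
    nonnegative A -> line_sums A r -> 0 < A i j ->
  exists2 s, positive_diagonal A s & s i = j.
Proof.
move=> A0 rA Aij; apply: contrapT => nos.
have r0 : 0 <= r by rewrite -(rA.1 i); apply: sumr_ge0.
have := @line_sums_weighted_sum A (fun i' j' => ((i' == i) && (j' == j))%:R)
  r 0 A0 rA r0.
move=> /(_ _)/wrap[s As|].
  rewrite big1 // => i' _; case: eqP => [->|//] /=.
  by case: eqP => // sij; case: nos; exists s.
rewrite mulr0 (bigD1 i) //= [X in _ + X]big1 ?addr0; last first.
  by move=> i' /negPf ->; rewrite big1 // => j' _; rewrite mulr0.
rewrite (bigD1 j) //= !eqxx mulr1 big1 ?addr0; last first.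
  by move=> j' /negPf ->; rewrite andbF mulr0.
by move=> A0'; rewrite A0' ltxx in Aij.
Qed.

Lemma positive_diagonalE A s :
  nonnegative A -> positive_diagonal A s <-> 0 < diagonal_product A s.
Proof.
move=> A0; split=> [As|]; first by apply: prodr_gt0 => i _.
move=> /lt0r_neq0/prodf_neq0 h i; rewrite lt_def A0 andbT; exact: h.
Qed.

Lemma ln_prod (I : finType) (F : I -> R) :
  (forall i, 0 < F i) -> ln (\prod_i F i) = \sum_i ln (F i).
Proof.
move=> F0; suff [] : 0 < \prod_i F i /\ ln (\prod_i F i) = \sum_i ln (F i) by [].
apply: (big_rec2 (fun p t => 0 < p /\ ln p = t)); first by rewrite ln1.
by move=> i p t _ [p0 <-]; rewrite mulr_gt0 // lnM // posrE.
Qed.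

Definition doubly_stochastic A := nonnegative A /\ line_sums A 1.

(* The log-ratios [ln (A i j) - ln (B i j)] have the same sum along all positive
   diagonals, hence the same average against [A] and against [B]; as [ln] is
   increasing, this forces [A = B]. *)
Lemma doubly_stochastic_proportional_eq A B k :
    doubly_stochastic A -> doubly_stochastic B -> 0 < k ->
    (forall s, diagonal_product B s = k * diagonal_product A s) ->
  A = B.
Proof.
move=> [A0 rA] [B0 rB] k0 BA.
have posAB s : positive_diagonal A s <-> positive_diagonal B s.
  by rewrite !positive_diagonalE // BA pmulr_rgt0.
have supp i j : (0 < A i j) = (0 < B i j).
  apply/idP/idP => /line_sums_total_support.
    by move=> /(_ _ A0 rA)[s /posAB Bs <-].
  by move=> /(_ _ B0 rB)[s /posAB As <-].
pose x i j := ln (A i j) - ln (B i j).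
have xc s : positive_diagonal A s -> \sum_i x i (s i) = - ln k.
  move=> As; have Bs := (posAB s).1 As; rewrite sumrB -!ln_prod //.
  rewrite -/(diagonal_product A s) -/(diagonal_product B s) BA.
  have dA : 0 < diagonal_product A s by exact/positive_diagonalE.
  by rewrite lnM ?posrE // opprD addrCA subrr addr0.
have eqx : \sum_i \sum_j A i j * x i j = \sum_i \sum_j B i j * x i j.
  rewrite (line_sums_weighted_sum A0 rA ler01 xc).
  by rewrite (line_sums_weighted_sum B0 rB ler01 (fun s h => xc s ((posAB s).2 h))).
have x0 i j : 0 <= (A i j - B i j) * x i j.
  have [Ap|An] := boolP (0 < A i j); last first.
    have Bn := An; rewrite supp -leNgt in Bn; rewrite -leNgt in An.
    (* Off the common support, [ln] takes its default value 0 on both entries. *)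
    by rewrite /x !ln0 // subrr mulr0.
  have Bp := Ap; rewrite supp in Bp.
  have [AB|/ltW AB] := leP (A i j) (B i j).
    by rewrite mulr_le0 // subr_le0 // ler_ln ?posrE.
  by rewrite mulr_ge0 // subr_ge0 // ler_ln ?posrE.
have sum0 : \sum_i \sum_j (A i j - B i j) * x i j = 0.
  rewrite -[RHS](subrr (\sum_i \sum_j B i j * x i j)) -{1}eqx -sumrB.
  apply: eq_bigr => i _; rewrite -sumrB; apply: eq_bigr => j _.
  by rewrite mulrBl.
apply/matrixP => i j.
have [Ap|An] := boolP (0 < A i j); last first.
  have Bn := An; rewrite supp in Bn.
  move: An Bn; rewrite !lt_def A0 B0 !andbT !negbK => /eqP -> /eqP ->//.
have Bp := Ap; rewrite supp in Bp.
have/(_ i isT) := psumr_eq0P (fun i _ => sumr_ge0 _ (fun j _ => x0 i j)) sum0.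
move/(psumr_eq0P (fun j _ => x0 i j))/(_ j isT)/eqP.
by rewrite mulf_eq0 !subr_eq0 => /orP[/eqP //|/eqP/ln_inj]; apply; rewrite posrE.
Qed.

End DiagonalsOfDoublyStochasticMatrices.

(** * Compactness, cluster points and continuity *)

Section ClusterPoints.
Local Open Scope classical_set_scope.

(** If a neighbourhood [U] of [p] were not in [F], then [F] restricted to the complement of [U]
    would be proper and have a cluster point in [V]. That point also clusters [F], so it is [p],
    which [U] separates from the complement. *)
Lemma compact_cluster_cvg (T : topologicalType) (F : set_system T) (V : set T)
    (p : T) :
  ProperFilter F -> compact V -> F V ->
  (forall q, V q -> cluster F q -> q = p) -> F --> p.
Proof.
move=> FF Vc FV Fp U Up; apply: contrapT => nFU.
have GG : ProperFilter (within (~` U) F).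
  split; last exact: within_filter.
  rewrite /within /= => F0; apply: nFU.
  apply: (@filterS _ F _ _ _ _ F0) => x /= h; exact: contrapT.
have GV : within (~` U) F V by apply: filterS FV.
have [q [Vq Gq]] := Vc _ GG GV.
have qp : q = p by apply: Fp Vq _; apply: cvg_cluster Gq; exact: cvg_within.
rewrite qp in Gq.
by have [x []] := Gq (~` U) U (withinT _ _) Up.
Qed.

(** A cluster point is the limit of a finer filter, along which [g] tends both to [g p] and to
    [l]. *)
Lemma cluster_cvg_eq (T U : topologicalType) (F : set_system T) (g : T -> U)
    (p : T) (l : U) :
  Filter F -> hausdorff_space U -> cluster F p -> {for p, continuous g} ->
  g @ F --> l -> g p = l.
Proof.
move=> FF hU; rewrite cluster_cvgE => -[G GG [Gp FG]] gp gl.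
apply: (cvg_unique hU (F := g @ G)); first exact: cvg_trans (cvg_app g Gp) gp.
by move=> W /gl; exact: FG.
Qed.

(** The box is the image under [vec_mx] of a compact box of row vectors. *)
Lemma mx_segment_compact (R : realType) (m n : nat) (a b : R) :
  compact [set A : 'M[R]_(m, n) | forall i j, a <= A i j <= b].
Proof.
have vec_continuous : continuous (@vec_mx R m n).
  move=> v U [W Wv WU].
  suff : nbhs v [set w : 'rV[R]_(m * n) |
      forall i j, W i j (w ord0 (mxvec_index i j))].
    by apply: filterS => w Ww; apply: WU => i j; rewrite mxE; exact: Ww.
  apply: (@filter_forall _ _ (fun i (w : 'rV[R]_(m * n)) =>
    forall j, W i j (w ord0 (mxvec_index i j))) (nbhs v)) => i.
  apply: (@filter_forall _ _ (fun j (w : 'rV[R]_(m * n)) =>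
    W i j (w ord0 (mxvec_index i j))) (nbhs v)) => j.
  apply: (@coord_continuous R 1 _ ord0 (mxvec_index i j) v (W i j)).
  by have := Wv i j; rewrite mxE.
have := @rV_compact R (m * n) (fun=> `[a, b]) (fun=> @segment_compact _ a b).
move/(continuous_compact (continuous_subspaceT vec_continuous)).
congr compact; apply/seteqP; split=> [_ [v vab <-] i j|A Aab].
  by have := vab (mxvec_index i j); rewrite mxE /= in_itv.
exists (mxvec A); last exact: mxvecK.
by move=> k; case/mxvec_indexP: k => i j; rewrite /= mxvecE in_itv /=.
Qed.

End ClusterPoints.

Section ContinuousBigops.
Context {R : realType} {n : nat}.
Implicit Types s : 'S_n.

Lemma diagonal_product_continuous s :
  continuous (fun A : 'M[R]_n => diagonal_product A s).
Proof.
apply: (continuous_big (@mul_continuous R)) => i _ A; exact: coord_continuous.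
Qed.

Lemma row_sum_continuous i : continuous (fun A : 'M[R]_n => \sum_j A i j).
Proof.
apply: continuous_big => [|j _ A]; last exact: coord_continuous.
exact: add_continuous.
Qed.

Lemma col_sum_continuous j : continuous (fun A : 'M[R]_n => \sum_i A i j).
Proof.
apply: continuous_big => [|i _ A]; last exact: coord_continuous.
exact: add_continuous.
Qed.

End ContinuousBigops.

(** * AM-GM and the effect of normalization on diagonal products *)

(** AM-GM with mean 1. In the equality case all terms agree, and the sum fixes their value at 1. The
    mean divides by [n], hence the separate case [n = 0]. *)
Lemma prod_leif1_of_sum (R : realType) (n : nat) (E : 'I_n -> R) :
    (forall i, 0 <= E i) -> \sum_i E i = n%:R ->
  \prod_i E i <= 1 ?= iff [forall i, E i == 1].
Proof.
case: n E => [|n] E E0 sumE.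
  by rewrite big_ord0; split => //; rewrite eqxx; apply/esym/forallP => -[].
have := leif_AGM (A := predT) (fun i _ => E0 i).
rewrite sumE card_ord divff ?pnatr_eq0 // expr1n => -[le1 eq1]; split => //.
rewrite eq1; apply/forallP/forallP => [Ec i|E1 i].
  have Ej j : E j = E i by apply/eqP/(forallP (Ec j)).
  move: sumE; rewrite (eq_bigr _ (fun j _ => Ej j)) sumr_const card_ord -[LHS]mulr_natl.
  rewrite -[RHS]mulr1 => /mulfI ->; first exact: eqxx.
  by rewrite pnatr_eq0.
by apply/implyP => _; apply/forallP => j; rewrite (eqP (E1 i)) (eqP (E1 j)) eqxx.
Qed.

Section Sinkhorn.
Local Open Scope classical_set_scope.
Context {R : realType} {n : nat}.
Implicit Types (A B M P Q : 'M[R]_n) (s t : 'S_n).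

Definition row_sum_prod A : R := \prod_i \sum_j A i j.

Definition col_sum_prod A : R := \prod_j \sum_i A i j.

(** For nonnegative matrices with a positive diagonal, a division-free form of cross ratio
    equivalence that also covers the zero products. *)
Definition diagonal_proportional M A : Prop :=
  exists2 c, 0 < c & forall s, diagonal_product A s = c * diagonal_product M s.

Lemma diagonal_product_row_normalize A s :
  diagonal_product (row_normalize A) s = (row_sum_prod A)^-1 * diagonal_product A s.
Proof.
rewrite mulrC -prodf_div; apply: eq_bigr => i _; exact: mxE.
Qed.

Lemma diagonal_product_col_normalize A s :
  diagonal_product (col_normalize A) s = (col_sum_prod A)^-1 * diagonal_product A s.
Proof.
(* A diagonal meets every column once, so the columns can be indexed by [s i]. *)
rewrite mulrC /col_sum_prod (reindex_perm s) -prodf_div.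
apply: eq_bigr => i _; exact: mxE.
Qed.

Section PositiveDiagonal.
Context (A : 'M[R]_n) (s : 'S_n) (A0 : nonnegative A) (As : positive_diagonal A s).

Lemma row_sum_gt0 i : 0 < \sum_j A i j.
Proof.
by rewrite (bigD1 (s i)) //= ltr_wpDr // sumr_ge0.
Qed.

Lemma col_sum_gt0 j : 0 < \sum_i A i j.
Proof.
rewrite (bigD1 (s^-1%g j)) //= ltr_wpDr //; first exact: sumr_ge0.
by have := As (s^-1%g j); rewrite permKV.
Qed.

Lemma row_normalize_ge0 : nonnegative (row_normalize A).
Proof. by move=> i j; rewrite mxE divr_ge0 // ltW // row_sum_gt0. Qed.

Lemma col_normalize_ge0 : nonnegative (col_normalize A).
Proof. by move=> i j; rewrite mxE divr_ge0 // ltW // col_sum_gt0. Qed.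

Lemma row_normalize_positive_diagonal : positive_diagonal (row_normalize A) s.
Proof. by move=> i; rewrite mxE divr_gt0 // row_sum_gt0. Qed.

Lemma col_normalize_positive_diagonal : positive_diagonal (col_normalize A) s.
Proof. by move=> i; rewrite mxE divr_gt0 // col_sum_gt0. Qed.

Lemma row_normalize_row_sum i : \sum_j row_normalize A i j = 1.
Proof.
rewrite (eq_bigr _ (fun j _ => mxE _ _ i j)) -mulr_suml divff //.
by rewrite gt_eqF // row_sum_gt0.
Qed.

Lemma col_normalize_col_sum j : \sum_i col_normalize A i j = 1.
Proof.
rewrite (eq_bigr _ (fun i _ => mxE _ _ i j)) -mulr_suml divff //.
by rewrite gt_eqF // col_sum_gt0.
Qed.

End PositiveDiagonal.

Lemma diagonal_proportional_unique M P Q :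
    doubly_stochastic P -> doubly_stochastic Q ->
    diagonal_proportional M P -> diagonal_proportional M Q -> P = Q.
Proof.
move=> dP dQ [c c0 Pc] [d d0 Qd].
apply: (doubly_stochastic_proportional_eq dP dQ (divr_gt0 d0 c0)) => s.
by rewrite Qd Pc mulrA divfK // gt_eqF.
Qed.

(** Stated for an arbitrary sequence [S] to serve both halves of the iteration. Limits of continuous
    functions of [S k] are their values at [Q]; products of line sums equal to 1 then make AM-GM an
    equality for [Q]. *)
Lemma cluster_doubly_stochastic M (s : 'S_n) (S : nat -> 'M[R]_n) (l : R) Q :
    positive_diagonal M s ->
    (forall k t, diagonal_product (S k) t * diagonal_product M s =
                 diagonal_product (S k) s * diagonal_product M t) ->
    (forall k, \sum_i \sum_j S k i j = n%:R) ->
    0 < l -> (fun k => diagonal_product (S k) s) @ \oo --> l ->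
    (fun k => row_sum_prod (S k)) @ \oo --> (1 : R) ->
    (fun k => col_sum_prod (S k)) @ \oo --> (1 : R) ->
    nonnegative Q -> cluster (S @ \oo) Q ->
  doubly_stochastic Q /\ diagonal_proportional M Q.
Proof.
move=> Ms Sprop Ssum l0 Sl Srow Scol Q0 SQ.
have limQ (g : 'M[R]_n -> R) (a : R) :
    continuous g -> (fun k => g (S k)) @ \oo --> a -> g Q = a.
  by move=> gc ga; exact: (cluster_cvg_eq _ (@norm_hausdorff _ R) SQ (gc Q) ga).
have Qsum : \sum_i \sum_j Q i j = n%:R.
  apply: (limQ (fun A => \sum_i \sum_j A i j)).
    apply: continuous_big => [|i _]; first exact: add_continuous.
    exact: row_sum_continuous.
  by rewrite (funext Ssum); exact: cvg_cst.
have Qrow : row_sum_prod Q = 1.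
  apply: (limQ row_sum_prod) => //.
  apply: continuous_big => [|i _]; first exact: mul_continuous.
  exact: row_sum_continuous.
have Qcol : col_sum_prod Q = 1.
  apply: (limQ col_sum_prod) => //.
  apply: continuous_big => [|i _]; first exact: mul_continuous.
  exact: col_sum_continuous.
have Ql : diagonal_product Q s = l.
  apply: (limQ (fun A => diagonal_product A s)) => //.
  exact: diagonal_product_continuous.
have dM0 : 0 < diagonal_product M s by apply: prodr_gt0 => i _; exact: Ms.
split.
  split=> //; split.
    have [_] := prod_leif1_of_sum (fun i => sumr_ge0 _ (fun j _ => Q0 i j)) Qsum.
    by rewrite -/(row_sum_prod Q) Qrow eqxx => /esym/forallP h i; exact/eqP.
  have [_] := prod_leif1_of_sum (fun j => sumr_ge0 _ (fun i _ => Q0 i j))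
    (etrans (exchange_big _ _ _ _ _ _) Qsum).
  by rewrite -/(col_sum_prod Q) Qcol eqxx => /esym/forallP h i; exact/eqP.
(* The factor is positive because [0 < l]: the diagonal product along [s] does not vanish in the
   limit. *)
exists (l / diagonal_product M s) => [|t]; first exact: divr_gt0.
rewrite -mulrA; apply: (limQ (fun A => diagonal_product A t)).
  exact: diagonal_product_continuous.
have -> : (fun k => diagonal_product (S k) t) = (fun k =>
    diagonal_product (S k) s * ((diagonal_product M s)^-1 * diagonal_product M t)).
  apply/funext => k; apply: (mulIf (lt0r_neq0 dM0)).
  by rewrite Sprop mulrA mulrAC divfK ?gt_eqF.
exact: cvgMr_tmp.
Qed.

End Sinkhorn.

(** * Convergence of the Sinkhorn iteration *)

Section SinkhornConvergence.
Local Open Scope classical_set_scope.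
Context {R : realType} {n : nat} (M : 'M[R]_n) (s : 'S_n).
Context (M0 : nonnegative M) (Ms : positive_diagonal M s).

Lemma SK_row_positive k :
  nonnegative (SK_row M k) /\ positive_diagonal (SK_row M k) s.
Proof.
rewrite /SK_row; set A := iter k _ M.
suff [A0 As] : nonnegative A /\ positive_diagonal A s.
  by split; [exact: row_normalize_ge0 As | exact: row_normalize_positive_diagonal].
rewrite /A; elim: k {A} => [//|k [A0 As]]; rewrite iterS; set A := iter k _ M in A0 As *.
have B0 := row_normalize_ge0 A0 As; have Bs := row_normalize_positive_diagonal A0 As.
by split; [exact: col_normalize_ge0 Bs | exact: col_normalize_positive_diagonal].
Qed.

Lemma SK_col_positive k :
  nonnegative (SK_col M k) /\ positive_diagonal (SK_col M k) s.
Proof.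
have [B0 Bs] := SK_row_positive k.
by split; [exact: col_normalize_ge0 Bs | exact: col_normalize_positive_diagonal].
Qed.

Lemma SK_rowS k : SK_row M k.+1 = row_normalize (SK_col M k).
Proof. by []. Qed.

Lemma SK_row_row_sum k i : \sum_j SK_row M k i j = 1.
Proof.
case: k => [|k]; first exact: row_normalize_row_sum Ms i.
by have [A0 As] := SK_col_positive k; rewrite SK_rowS (row_normalize_row_sum A0 As).
Qed.

Lemma SK_col_col_sum k j : \sum_i SK_col M k i j = 1.
Proof. by have [A0 As] := SK_row_positive k; exact: col_normalize_col_sum As j. Qed.

Lemma SK_row_sum k : \sum_i \sum_j SK_row M k i j = n%:R.
Proof.
by rewrite (eq_bigr _ (fun i _ => SK_row_row_sum k i)) sumr_const card_ord.
Qed.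

Lemma SK_col_sum k : \sum_i \sum_j SK_col M k i j = n%:R.
Proof.
rewrite exchange_big (eq_bigr _ (fun j _ => SK_col_col_sum k j)).
by rewrite sumr_const card_ord.
Qed.

Lemma SK_row_segment k i j : 0 <= SK_row M k i j <= 1.
Proof.
have [A0 _] := SK_row_positive k; rewrite A0 -(SK_row_row_sum k i) (bigD1 j) //=.
by rewrite lerDl sumr_ge0.
Qed.

Lemma SK_col_segment k i j : 0 <= SK_col M k i j <= 1.
Proof.
have [A0 _] := SK_col_positive k; rewrite A0 -(SK_col_col_sum k j) (bigD1 i) //=.
by rewrite lerDl sumr_ge0.
Qed.

(** The monotone quantity of the proof, interleaved as [u 0 <= v 0 <= u 1 <= v 1 <= ...]. *)
Let u k := diagonal_product (SK_row M k) s.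
Let v k := diagonal_product (SK_col M k) s.

Let u_gt0 k : 0 < u k.
Proof. by have [_ As] := SK_row_positive k; apply: prodr_gt0 => i _. Qed.

Let v_gt0 k : 0 < v k.
Proof. by have [_ As] := SK_col_positive k; apply: prodr_gt0 => i _. Qed.

(** Products of line sums are ratios of consecutive terms of the interleaved sequence, so they tend
    to 1 once that sequence has a positive limit. *)
Lemma SK_row_col_sum_prod k : col_sum_prod (SK_row M k) = u k / v k.
Proof.
have [A0 As] := SK_row_positive k; rewrite /v /SK_col diagonal_product_col_normalize.
by rewrite invfM invrK mulrCA divff ?mulr1 // gt_eqF //; exact: u_gt0.
Qed.

Lemma SK_col_row_sum_prod k : row_sum_prod (SK_col M k) = v k / u k.+1.
Proof.
rewrite /u SK_rowS diagonal_product_row_normalize.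
by rewrite invfM invrK mulrCA divff ?mulr1 // gt_eqF //; exact: v_gt0.
Qed.

Lemma SK_row_row_sum_prod k : row_sum_prod (SK_row M k) = 1.
Proof. by apply: big1 => i _; exact: SK_row_row_sum. Qed.

Lemma SK_col_col_sum_prod k : col_sum_prod (SK_col M k) = 1.
Proof. by apply: big1 => i _; exact: SK_col_col_sum. Qed.

Let u_le_v k : u k <= v k.
Proof.
have [A0 As] := SK_row_positive k.
rewrite -[leRHS]mul1r -ler_pdivrMr; last exact: v_gt0.
rewrite -SK_row_col_sum_prod.
by have [] := prod_leif1_of_sum (fun j => sumr_ge0 _ (fun i _ => A0 i j))
  (etrans (exchange_big _ _ _ _ _ _) (SK_row_sum k)).
Qed.

Let v_le_u k : v k <= u k.+1.
Proof.
have [A0 As] := SK_col_positive k.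
rewrite -[leRHS]mul1r -ler_pdivrMr; last exact: u_gt0.
rewrite -SK_col_row_sum_prod.
by have [] := prod_leif1_of_sum (fun i => sumr_ge0 _ (fun j _ => A0 i j)) (SK_col_sum k).
Qed.

(** The sequence [u] increases and is bounded by 1 because the entries are; its limit is at least
    [u 0 > 0]. The sequence [v] is squeezed between [u] and its shift. *)
Let u_cvg : exists2 l : R, 0 < l & u @ \oo --> l /\ v @ \oo --> l.
Proof.
have u_nd : {homo u : k m / (k <= m)%N >-> k <= m}.
  by apply/nondecreasing_seqP => k; exact: le_trans (u_le_v k) (v_le_u k).
have u_cv : cvgn u.
  apply: nondecreasing_is_cvgn => //; exists 1 => _ [k _ <-].
  by apply: prodr_ile1 => i _; exact: SK_row_segment.
exists (limn u).
  exact: lt_le_trans (u_gt0 0) (nondecreasing_cvgn_le u_nd u_cv 0).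
split => //; apply: (squeeze_cvgr (f := u) (h := fun k => u k.+1)) => //.
  by apply: nearW => k; rewrite u_le_v v_le_u.
by rewrite (cvg_shiftS u).
Qed.

Let SK_row_proportional k t :
  diagonal_product (SK_row M k) t * diagonal_product M s =
  u k * diagonal_product M t.
Proof.
rewrite /u; elim: k => [|k IHk].
  by rewrite /SK_row !diagonal_product_row_normalize mulrAC.
rewrite SK_rowS !diagonal_product_row_normalize !diagonal_product_col_normalize.
by rewrite -!mulrA IHk.
Qed.

Let SK_col_proportional k t :
  diagonal_product (SK_col M k) t * diagonal_product M s =
  v k * diagonal_product M t.
Proof.
rewrite /v !diagonal_product_col_normalize -!mulrA; congr (_ * _).
exact: SK_row_proportional.
Qed.

Lemma SK_cvg : exists P, [/\ doubly_stochastic P, diagonal_proportional M P,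
  SK_row M @ \oo --> P & SK_col M @ \oo --> P].
Proof.
have [l l0 [ul vl]] := u_cvg.
pose V := [set A : 'M[R]_n | forall i j, 0 <= A i j <= 1].
have V0 A : V A -> nonnegative A by move=> VA i j; case/andP: (VA i j).
have Vc : compact V by exact: mx_segment_compact.
have Vrow : (SK_row M @ \oo) V by exists 0%N => // k _ i j; exact: SK_row_segment.
have Vcol : (SK_col M @ \oo) V by exists 0%N => // k _ i j; exact: SK_col_segment.
have ratio_cvg (f g : nat -> R) : f @ \oo --> l -> g @ \oo --> l ->
    (fun k => f k / g k) @ \oo --> (1 : R).
  move=> fl gl; rewrite -(divff (lt0r_neq0 l0)).
  exact: (cvgM fl (cvgV (lt0r_neq0 l0) gl)).
have rowP Q : V Q -> cluster (SK_row M @ \oo) Q ->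
    doubly_stochastic Q /\ diagonal_proportional M Q.
  move=> VQ; apply: (cluster_doubly_stochastic Ms _ SK_row_sum l0 ul).
  - exact: SK_row_proportional.
  - by rewrite (funext SK_row_row_sum_prod); exact: cvg_cst.
  - by rewrite (funext SK_row_col_sum_prod); exact: ratio_cvg.
  - exact: V0.
have colP Q : V Q -> cluster (SK_col M @ \oo) Q ->
    doubly_stochastic Q /\ diagonal_proportional M Q.
  move=> VQ; apply: (cluster_doubly_stochastic Ms _ SK_col_sum l0 vl).
  - exact: SK_col_proportional.
  - rewrite (funext SK_col_row_sum_prod); apply: ratio_cvg => //.
    by rewrite (cvg_shiftS u).
  - by rewrite (funext SK_col_col_sum_prod); exact: cvg_cst.
  - exact: V0.
(* A cluster point of the row half is chosen; by uniqueness it is the only possible cluster point in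
   [V] of either half. *)
have [P [VP rowPcl]] := Vc _ _ Vrow.
have [dP pP] := rowP P VP rowPcl.
exists P; split=> //.
  apply: (compact_cluster_cvg _ Vc Vrow) => Q VQ /(rowP Q VQ)[dQ pQ].
  exact: diagonal_proportional_unique pQ pP.
apply: (compact_cluster_cvg _ Vc Vcol) => Q VQ /(colP Q VQ)[dQ pQ].
exact: diagonal_proportional_unique pQ pP.
Qed.

End SinkhornConvergence.

(** * The cooperative index under cross ratio equivalence *)

(** By uniqueness such a [P] is the limit of both halves of the iteration, so the index can be read
    off from it. *)
Lemma cooperative_index_eq (R : realType) (n : nat) (M P : 'M[R]_n) :
    has_positive_diagonal M -> doubly_stochastic P -> diagonal_proportional M P ->
  cooperative_index M = n%:R^-1 * \sum_i \sum_j P i j ^+ 2.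
Proof.
move=> [[M0 _ _] [s Ms]] dP pP.
have [Q [dQ pQ rowQ colQ]] := SK_cvg M0 Ms.
rewrite /cooperative_index /SK_row_lim /SK_col_lim.
rewrite (cvg_lim (@norm_hausdorff _ _) rowQ) (cvg_lim (@norm_hausdorff _ _) colQ).
by rewrite (diagonal_proportional_unique dQ dP pQ pP).
Qed.

Lemma cross_ratio_equivalent_proportional (R : realType) (n : nat)
    (A B : 'M[R]_n) :
    has_positive_diagonal A -> nonnegative B -> cross_ratio_equivalent A B ->
  diagonal_proportional A B.
Proof.
move=> [[A0 _ _] [s As]] B0 [AB0 ABr].
have dA : 0 < diagonal_product A s by exact/positive_diagonalE.
have dB : 0 < diagonal_product B s.
  by rewrite lt_def (AB0 s).1 ?gt_eqF // prodr_ge0.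
exists (diagonal_product B s / diagonal_product A s); first exact: divr_gt0.
(* The ratio condition concerns positive diagonals only; zero products are settled by the first
   clause of the equivalence. *)
move=> t; have [At|/negPn/eqP At] := boolP (diagonal_product A t != 0); last first.
  rewrite At mulr0; apply/eqP/negPn/negP => /(AB0 t).2.
  by rewrite At eqxx.
have pAt : positive_diagonal A t.
  by apply/positive_diagonalE => //; rewrite lt_def At prodr_ge0.
have := ABr t s pAt As => /(congr1 ( *%R (diagonal_product B s))).
by rewrite [RHS]mulrCA divff ?mulr1 ?gt_eqF // => <-; rewrite mulrA mulrAC.
Qed.

Theorem corollary20 (R : realType) (n : nat) (hn : (0 < n)%N)
    (M1 M2 : 'M[R]_n)
    (hM1 : has_positive_diagonal M1) (hM2 : has_positive_diagonal M2)
    (hM12 : cross_ratio_equivalent M1 M2) :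
  cooperative_index M1 = cooperative_index M2.
Proof.
have [[M10 _ _] [s1 M1s]] := hM1; have [[M20 _ _] _] := hM2.
have [P [dP [c c0 Pc] _ _]] := SK_cvg M10 M1s.
have [d d0 M2d] := cross_ratio_equivalent_proportional hM1 M20 hM12.
rewrite (cooperative_index_eq hM1 dP); last by exists c.
rewrite (cooperative_index_eq hM2 dP) //.
(* The limit [P] for [M1] is [c] times [M1] on diagonal products and [M2] is [d] times [M1], so [P]
   is also the limit for [M2]. *)
exists (c / d) => [|t]; first exact: divr_gt0.
by rewrite M2d mulrA divfK ?gt_eqF.
Qed.
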